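(* Let $A,B\in\mathcal{S}_n$, $X\in\mathcal{M}_n$ and $r\ge 0$, and let $|||\cdot|||$ be a unitarily invariant norm on $\mathcal{M}_n$. Then the function $$F(s,t)=|||\,|A^{1-t}XB^{1+s}|^r\,|||\;|||\,|A^{1+t}XB^{1-s}|^r\,|||$$ is convex on $[-1,1]\times[-1,1]$ and attains its minimum at $(0,0)$.
   Context: $\mathcal{M}_n$ is the algebra of $n\times n$ complex matrices, and $\mathcal{S}_n\subset\mathcal{M}_n$ is the set of positive semidefinite matrices. For $T\in\mathcal{M}_n$, $|T|=(T^*T)^{1/2}$. Nonnegative real powers of positive semidefinite matrices are taken by functional calculus, with the zeroth power equal to the identity matrix. A norm $|||\cdot|||$ on $\mathcal{M}_n$ is unitarily invariant if $|||UTV|||=|||T|||$ for all $T\in\mathcal{M}_n$ and all unitary $U,V\in\mathcal{M}_n$. A real-valued function $F$ on $J_1\times J_2$ (with $J_1,J_2$ intervals) is convex if $F(\lambda x_1+(1-\lambda)x_2,\lambda y_1+(1-\lambda)y_2)\le\lambda F(x_1,y_1)+(1-\lambda)F(x_2,y_2)$ for all $x_1,x_2\in J_1$, $y_1,y_2\in J_2$, $\lambda\in[0,1]$. *)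

(* Defs.v *)
From HB Require Import structures.
From mathcomp Require Import all_boot all_order all_algebra.
From mathcomp Require Import sesquilinear spectral complex.
From mathcomp Require Import all_classical all_reals all_analysis.

Set Implicit Arguments.
Unset Strict Implicit.
Unset Printing Implicit Defensive.

Import Order.TTheory GRing.Theory Num.Theory.
Local Open Scope ring_scope.
Local Open Scope complex_scope.
Local Open Scope sesquilinear_scope.

Definition psdmx (R : realType) (n : nat) (A : 'M[R[i]]_n) : Prop :=
  A \is hermsymmx /\ forall v : 'cV[R[i]]_n, 0 <= (v ^t* *m A *m v) 0 0.

(* Functional calculus for Hermitian A: f acts on the eigenvalues in the
   spectral decomposition A = P^-1 *m diag_mx D *m P, P unitary, D real
   (orthomx_spectralP, hermitian_spectral_diag_real). *)
Definition hermfun (R : realType) (n : nat) (f : R -> R) (A : 'M[R[i]]_n) :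
    'M[R[i]]_n :=
  invmx (spectralmx A)
    *m diag_mx (map_mx (fun z : R[i] => (f (complex.Re z))%:C) (spectral_diag A))
    *m spectralmx A.

(* Since powR a 0 = 1 for every a, including a = 0, mxpowR A 0 is the
   identity even when A is singular; for s > 0, powR 0 s = 0. *)
Definition mxpowR (R : realType) (n : nat) (A : 'M[R[i]]_n) (s : R) :
    'M[R[i]]_n :=
  hermfun (fun x : R => powR x s) A.

Definition mxabs (R : realType) (n : nat) (T : 'M[R[i]]_n) : 'M[R[i]]_n :=
  mxpowR (T ^t* *m T) 2^-1.

(* `|a| is R[i]-valued (and real), hence the Re. *)
Record is_mxnorm (R : realType) (n : nat) (N : 'M[R[i]]_n -> R) : Prop :=
  IsMxNorm {
    mxnorm_ge0 : forall T, 0 <= N T;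
    mxnorm_eq0 : forall T, N T = 0 -> T = 0;
    mxnormZ : forall (a : R[i]) T, N (a *: T) = complex.Re `|a| * N T;
    mxnormD : forall S T, N (S + T) <= N S + N T
  }.

Definition unitarily_invariant (R : realType) (n : nat)
    (N : 'M[R[i]]_n -> R) : Prop :=
  forall T U V : 'M[R[i]]_n, U \is unitarymx -> V \is unitarymx ->
    N (U *m T *m V) = N T.

(* Main.v *)
Require Import Defs.
From HB Require Import structures.
From mathcomp Require Import all_boot all_order all_algebra.
From mathcomp Require Import all_fingroup.
From mathcomp Require Import sesquilinear spectral complex.
From mathcomp Require Import all_classical all_reals all_analysis.
From mathcomp Require Import ring lra.
Set Implicit Arguments.
Unset Strict Implicit.
Unset Printing Implicit Defensive.
Import Order.TTheory GRing.Theory Num.Theory.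
Local Open Scope classical_set_scope.
Local Open Scope ring_scope.
Local Open Scope sesquilinear_scope.

(** Write G a b for the norm of |A^a X B^b|^r, so that
    F s t = G (1 - t) (1 + s) * G (1 + t) (1 - s).  Everything follows from the
    midpoint log-convexity of G in both exponents together,

      G ((a + a') / 2) ((b + b') / 2) ^ 2 <= G a b * G a' b',

    [power_norm_midpoint].  By it F is midpoint convex; since F is bounded on
    the square, it is convex there [midpoint_convex_bounded].  Boundedness has
    to stand in for continuity: the zeroth power of a singular matrix is the
    identity, so F may jump on the edges of the square.  The minimum at the
    origin is the midpoint inequality between (s, t) and (-s, -t), where F takes
    equal values.

    Let P, Q be the half-steps A^v, B^u and Y the product at one corner.  The
    middle product is P Y Q.  When both exponents grow in the same direction the
    ends are Y and P P Y Q Q, otherwise they are P P Y and Y Q Q.  In both cases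
    the Gram matrix of P Y Q has the shape Q M, with M Q the product Z1^H Z2 of
    the end matrices (H denotes the adjoint): this is all that relates the three
    matrices.  As Q M and M Q have the same spectrum, the largest singular value
    of P Y Q is at most the geometric mean of those of Z1 and Z2.  Doing the
    same with k by k determinants in place of norms, via the Cauchy-Binet
    formula, gives log-majorization: the product of the k largest singular
    values of P Y Q is at most the geometric mean of the corresponding products
    for Z1 and Z2 [spectral_prefix_le].

    A unitarily invariant norm is a symmetric gauge function of the singular
    values, and such a function respects weak log-majorization
    [gauge_log_majorization].  Raising to the power r keeps products in order,
    and bounding a geometric mean of x and y by (c x + y / c) / 2 for every
    c > 0 turns the comparison into a Cauchy-Schwarz inequality for the norm
    [spectral_norm_sq_le]. *)

(** * Gram determinants and the Cauchy-Binet formula *)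

(** Expanding the determinant row by row: each row of the product is a
    combination of rows of [B]. *)
Lemma det_mulmx_ffun (R : comNzRingType) k n (A : 'M[R]_(k, n))
    (B : 'M[R]_(n, k)) :
  \det (A *m B) =
  \sum_(f : {ffun 'I_k -> 'I_n}) (\prod_i A i (f i)) * \det (rowsub f B).
Proof.
rewrite /determinant.
under eq_bigr do under eq_bigr do rewrite mxE.
under eq_bigr do rewrite bigA_distr_bigA /= mulr_sumr.
rewrite exchange_big /=; apply: eq_bigr => f _.
rewrite mulr_sumr; apply: eq_bigr => s _.
rewrite big_split /= mulrCA; congr (_ * (_ * _)).
by apply: eq_bigr => i _; rewrite mxE.
Qed.

(** The Cauchy-Binet formula, summed over all index functions instead of
    increasing ones.  Non-injective functions contribute zero and each k-subset
    is counted once per ordering, whence the factorial. *)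
Lemma cauchy_binet (R : comNzRingType) k n (A : 'M[R]_(k, n))
    (B : 'M[R]_(n, k)) :
  (k`!)%:R * \det (A *m B) =
  \sum_(f : {ffun 'I_k -> 'I_n}) \det (colsub f A) * \det (rowsub f B).
Proof.
under eq_bigr do rewrite {1}/determinant mulr_suml.
rewrite exchange_big /= -(card_Sn k).
rewrite -sum1_card natr_sum mulr_suml.
rewrite [LHS](eq_bigl predT) => [|s]; last by rewrite !inE.
apply: eq_bigr => s _; rewrite mul1r det_mulmx_ffun.
(* each permutation [s] contributes the same total: reindex by [f |-> f \o s],
   whose sign is absorbed by permuting the rows of the minor of [B] *)
pose h (f : {ffun 'I_k -> 'I_n}) : {ffun 'I_k -> 'I_n} := [ffun i => f (s i)].
pose h' (f : {ffun 'I_k -> 'I_n}) : {ffun 'I_k -> 'I_n} :=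
  [ffun i => f ((s^-1)%g i)].
rewrite (reindex h) /=; last first.
  exists h' => f _; apply/ffunP => i; rewrite !ffunE.
    by rewrite permKV.
  by rewrite permK.
apply: eq_bigr => f _.
have -> : rowsub (h f) B = row_perm s (rowsub f B).
  by apply/matrixP => i j; rewrite !mxE ffunE.
rewrite row_permE det_mulmx det_perm.
rewrite mulrA; congr (_ * _); rewrite mulrC; congr (_ * _).
by apply: eq_bigr => i _; rewrite !mxE ffunE.
Qed.

Lemma cauchy_schwarz_sum (C : numClosedFieldType) (I : finType) (x y : I -> C) :
  `|\sum_i x i * (y i)^*%R| ^+ 2 <=
  (\sum_i `|x i| ^+ 2) * (\sum_i `|y i| ^+ 2).
Proof.
pose v (z : I -> C) : 'rV[C]_(#|I|) := \row_i z (enum_val i).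
have dE z t : dotmx (v z) (v t) = \sum_i z i * (t i)^*%R.
  rewrite dotmxE mxE (reindex_onto (@enum_val I predT) enum_rank) /=; last first.
    by move=> i _; rewrite enum_rankK.
  by apply: eq_big => [i|i _]; rewrite ?enum_valK ?eqxx // !mxE.
have := (CauchySchwarz (@dotmx C _) (v x) (v y)).1.
rewrite /= -!/(dotmx _ _) !dE; under [X in _ <= X * _]eq_bigr do rewrite -normCK.
by under [X in _ <= _ * X]eq_bigr do rewrite -normCK.
Qed.

Lemma adjmx_mul (C : numClosedFieldType) m n p (A : 'M[C]_(m, n)) (B : 'M[C]_(n, p)) :
  (A *m B)^t* = B^t* *m A^t*.
Proof. by rewrite trmx_mul map_mxM. Qed.

Lemma det_adjmx (C : numClosedFieldType) n (A : 'M[C]_n) :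
  \det (A^t*) = (\det A)^*%R.
Proof. by rewrite det_map_mx det_tr. Qed.

Lemma gram_minors (C : numClosedFieldType) k n (G H : 'M[C]_(n, k)) :
  k`!%:R * \det (G^t* *m H) =
  \sum_(f : {ffun 'I_k -> 'I_n}) \det (rowsub f H) * (\det (rowsub f G))^*%R.
Proof.
rewrite cauchy_binet; apply: eq_bigr => f _.
rewrite mulrC -det_adjmx; congr (_ * \det _).
by apply/matrixP => i j; rewrite !mxE.
Qed.

(** By Cauchy-Binet this is the Cauchy-Schwarz inequality for the vectors of
    maximal minors of [G] and [H]. *)
Lemma gram_det_cauchy_schwarz (C : numClosedFieldType) k n (G H : 'M[C]_(n, k)) :
  `|\det (G^t* *m H)| ^+ 2 <= \det (G^t* *m G) * \det (H^t* *m H).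
Proof.
have k0 : 0 < k`!%:R :> C by rewrite ltr0n fact_gt0.
rewrite -(ler_pM2l (exprn_gt0 2 k0)).
rewrite -[X in X ^+ 2 * `|_| ^+ 2](ger0_norm (ltW k0)) -exprMn -normrM gram_minors.
rewrite [in leRHS]expr2 mulrACA !gram_minors.
apply: le_trans (cauchy_schwarz_sum _ _) _.
rewrite mulrC; under eq_bigr do rewrite normCK.
by under [X in _ * X]eq_bigr do rewrite normCK.
Qed.

Lemma gram_det_ge0 (C : numClosedFieldType) k n (G : 'M[C]_(n, k)) :
  0 <= \det (G^t* *m G).
Proof.
have k0 : 0 < k`!%:R :> C by rewrite ltr0n fact_gt0.
rewrite -(pmulr_rge0 _ k0) gram_minors.
by apply: sumr_ge0 => f _; rewrite mul_conjC_ge0.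
Qed.

Lemma gram_det_gt0 (C : numClosedFieldType) k n (W : 'M[C]_(k, n)) :
  row_free W -> 0 < \det (W *m W^t*).
Proof.
move=> Wfree; rewrite lt_def; apply/andP; split.
  apply/det0P => -[v v0 vWW].
  have : dotmx (v *m W) (v *m W) == 0.
    by rewrite dotmxE adjmx_mul mulmxA -(mulmxA v) vWW mul0mx mxE.
  rewrite dnorm_eq0 mulmx_free_eq0 // => /eqP v00.
  by rewrite v00 eqxx in v0.
by rewrite -{1}[W]trmxCK gram_det_ge0.
Qed.

(** Among the products of k distinct terms of a decreasing sequence, the
    largest is that of the first k: the indices outside the prefix carry
    terms below [d k], those missing from it carry terms above [d k]. *)
Lemma prod_inj_le_prefix (R : numDomainType) n (d : nat -> R) k
    (f : 'I_k -> 'I_n) :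
  (forall i, 0 <= d i) -> (forall i j, (i <= j)%N -> d j <= d i) ->
  injective f -> \prod_(i < k) d (f i) <= \prod_(i < k) d i.
Proof.
move=> d0 dd finj.
have lekn : (k <= n)%N by have := leq_card f finj; rewrite !card_ord.
pose J := [set f i | i : 'I_k]%SET.
pose I := [set widen_ord lekn i | i : 'I_k]%SET.
have cJ : #|J| = k by rewrite card_imset // card_ord.
have wi : injective (widen_ord lekn) by move=> i j /(congr1 val) /= /val_inj.
have cI : #|I| = k by rewrite card_imset // card_ord.
have -> : \prod_(i < k) d (f i) = \prod_(j in J) d j.
  by rewrite big_imset //= => i j _ _; apply: finj.
have -> : \prod_(i < k) d i = \prod_(j in I) d j.
  by rewrite big_imset //= => i j _ _; apply: wi.
rewrite (big_setID I) /= [leRHS](big_setID J) /= finset.setIC.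
apply: ler_wpM2l; first exact: prodr_ge0.
have ID : #|(J :\: I)%SET| = #|(I :\: J)%SET|.
  by rewrite !cardsD cI cJ finset.setIC.
apply: (@le_trans _ _ (d k ^+ #|(J :\: I)%SET|)).
  rewrite -prodr_const; apply: ler_prod => i; rewrite finset.inE => /andP[iI _].
  rewrite d0 /= dd // leqNgt; apply: contra iI => ik.
  by apply/imsetP; exists (Ordinal ik) => //; apply: val_inj.
rewrite ID -prodr_const; apply: ler_prod => i; rewrite finset.inE => /andP[_].
case/imsetP => j _ ->; rewrite d0 /= dd //=.
exact: ltnW.
Qed.

(** * Log-majorization of the spectrum of a product *)

(** A function of a matrix does not depend on the unitary diagonalization.
    The change of basis [W] intertwines the diagonals [d] and [e], so [W i j]
    vanishes unless [d i = e j], and then it intertwines their images too. *)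
Lemma spectral_fun_unique (C : numClosedFieldType) n (f : C -> C)
    (S U : 'M[C]_n) (d e : 'rV[C]_n) :
  S \is unitarymx -> U \is unitarymx ->
  S^t* *m diag_mx d *m S = U^t* *m diag_mx e *m U ->
  S^t* *m diag_mx (map_mx f d) *m S = U^t* *m diag_mx (map_mx f e) *m U.
Proof.
move=> Su Uu SU.
pose W := S *m U^t*.
have WE : diag_mx d *m W = W *m diag_mx e.
  rewrite /W -[LHS]mul1mx -(unitarymxP Su) !mulmxA.
  by rewrite -(mulmxA S) -(mulmxA S) SU !mulmxA mulmxtVK.
have SW : S = W *m U by rewrite /W mulmxKtV.
have UW : U^t* = S^t* *m W.
  by rewrite /W mulmxA -[S^t*]mul1mx mulmxKtV // mul1mx.
clearbody W; rewrite UW {2}SW !mulmxA; congr (_ *m _); rewrite -!mulmxA; congr (_ *m _).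
apply/matrixP => i j; move/matrixP/(_ i j): WE.
rewrite !mul_diag_mx !mul_mx_diag !(mxE, mul_diag_mx, mul_mx_diag).
have [->|W0 E] := eqVneq (W i j) 0; first by rewrite !mulr0 !mul0r.
have -> : d 0 i = e 0 j by apply: (mulIf W0); rewrite E mulrC.
by rewrite mulrC.
Qed.

Lemma conj_row_perm_diag (C : numClosedFieldType) n (s : 'S_n) (U : 'M[C]_n)
    (d : 'rV[C]_n) :
  (row_perm s U)^t* *m diag_mx (col_perm s d) *m row_perm s U =
  U^t* *m diag_mx d *m U.
Proof.
apply/matrixP => i j; rewrite !mxE [RHS](reindex_inj (@perm_inj _ s)) /=.
by apply: eq_bigr => l _; rewrite !mul_mx_diag !mxE.
Qed.

Lemma row_perm_unitary (C : numClosedFieldType) n (s : 'S_n) (U : 'M[C]_n) :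
  U \is unitarymx -> row_perm s U \is unitarymx.
Proof.
move=> /unitarymxP /matrixP Uu; apply/unitarymxP/matrixP => i j.
have := Uu (s i) (s j); rewrite !mxE (inj_eq perm_inj) => <-.
by apply: eq_bigr => l _; rewrite !mxE.
Qed.

Lemma gram_spectral_ge0 (C : numClosedFieldType) n (T U : 'M[C]_n)
    (d : 'rV[C]_n) :
  U \is unitarymx -> T^t* *m T = U^t* *m diag_mx d *m U -> forall l, 0 <= d 0 l.
Proof.
move=> Uu TU l.
have : (U *m (T^t* *m T) *m U^t*) l l = d 0 l.
  rewrite TU !mulmxA mulmxtVK // (unitarymxP Uu) mul1mx.
  by rewrite mxE eqxx mulr1n.
have -> : U *m (T^t* *m T) *m U^t* = (T *m U^t*)^t* *m (T *m U^t*).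
  by rewrite adjmx_mul trmxCK !mulmxA.
move=> <-; rewrite mxE; apply: sumr_ge0 => i _.
by rewrite !mxE mulrC mul_conjC_ge0.
Qed.

(** The eigenvalues are indexed by all naturals so that the products of the
    first k of them can be written for k independent of the dimension. *)
Definition seqdiag (C : nmodType) n (d : nat -> C) : 'M[C]_n :=
  diag_mx (\row_l d l).

(** In an eigenbasis of [S], Cauchy-Binet writes the left side as the sum for
    [W *m W^t*] with the term of each minor weighted by a product of k distinct
    eigenvalues. *)
Lemma gram_det_le_prefix (C : numClosedFieldType) k n (W : 'M[C]_(k, n))
    (S U : 'M[C]_n) (d : nat -> C) :
  U \is unitarymx -> S = U^t* *m seqdiag n d *m U ->
  (forall i, 0 <= d i) -> (forall i j, (i <= j)%N -> d j <= d i) ->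
  \det (W *m S *m W^t*) <= (\prod_(i < k) d i) * \det (W *m W^t*).
Proof.
move=> Uu -> d0 dd.
pose V := U *m W^t*.
have Vt : W *m U^t* = V^t* by rewrite /V adjmx_mul trmxCK.
have -> : W *m (U^t* *m seqdiag n d *m U) *m W^t* = V^t* *m (seqdiag n d *m V).
  by rewrite -Vt !mulmxA.
have -> : W *m W^t* = V^t* *m V.
  by rewrite -Vt /V mulmxA mulmxKtV.
have k0 : 0 < k`!%:R :> C by rewrite ltr0n fact_gt0.
rewrite -(ler_pM2l k0) mulrCA !gram_minors mulr_sumr; apply: ler_sum => f _.
have -> : rowsub f (seqdiag n d *m V) =
    diag_mx (\row_i d (f i)) *m rowsub f V.
  by apply/matrixP => i j; rewrite mxE !mul_diag_mx !mxE.
rewrite det_mulmx det_diag -mulrA.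
under eq_bigr do rewrite mxE.
have [/injectiveP fi|/injectivePn [i1 [i2 i12 fi]]] := boolP (injectiveb f).
  by rewrite ler_wpM2r ?mul_conjC_ge0 //; apply: prod_inj_le_prefix.
rewrite (determinant_alternate i12) ?mul0r ?mulr0 // => j.
by rewrite !mxE fi.
Qed.

(** Weak log-majorization of the spectrum of [Q *m M] by those of the factors
    of [M *m Q].  The first k eigenvectors span a space on which [Q *m M] acts
    with determinant the product on the left; multiplying them by [Q] carries it
    to an invariant space of [M *m Q] with the same determinant.  That
    determinant is the ratio of Gram-type determinants in [key], which the
    determinantal Cauchy-Schwarz inequality separates into one factor for
    [Z1] and one for [Z2]. *)
Lemma spectral_prefix_le (C : numClosedFieldType) n (T Q M Z1 Z2 : 'M[C]_n)
    (U U1 U2 : 'M[C]_n) (d d1 d2 : nat -> C) k :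
  T^t* *m T = Q *m M -> M *m Q = Z1^t* *m Z2 ->
  U \is unitarymx -> U1 \is unitarymx -> U2 \is unitarymx ->
  T^t* *m T = U^t* *m seqdiag n d *m U ->
  Z1^t* *m Z1 = U1^t* *m seqdiag n d1 *m U1 ->
  Z2^t* *m Z2 = U2^t* *m seqdiag n d2 *m U2 ->
  (forall i, 0 <= d i) -> (forall i, 0 <= d1 i) -> (forall i, 0 <= d2 i) ->
  (forall i j, (i <= j)%N -> d1 j <= d1 i) ->
  (forall i j, (i <= j)%N -> d2 j <= d2 i) ->
  (k <= n)%N ->
  (\prod_(i < k) d i) ^+ 2 <= (\prod_(i < k) d1 i) * (\prod_(i < k) d2 i).
Proof.
move=> TQM MQ Uu U1u U2u TU Z1U Z2U d_ge0 d1_ge0 d2_ge0 dd1 dd2 kn.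
set p := \prod_(i < k) d i.
have p_ge0 : 0 <= p by apply: prodr_ge0.
have [->|p0] := eqVneq p 0; first by rewrite expr0n mulr_ge0 ?prodr_ge0.
pose V := rowsub (widen_ord kn) U.
pose D := diag_mx (\row_(i < k) d i).
have detD : \det D = p by rewrite det_diag; under eq_bigr do rewrite mxE.
have VT : V *m (T^t* *m T) = D *m V.
  rewrite TU /V /D mul_rowsub_mx !mulmxA.
  have -> : U *m U^t* = 1%:M by apply/unitarymxP.
  rewrite mul1mx; apply/matrixP => i j.
  by rewrite mxE !mul_diag_mx !mxE.
(* row vectors: [V] holds the first [k] eigenvectors of [Q *m M], so the rows
   of [V *m Q] span an invariant space of [M *m Q] *)
pose W := V *m Q.
have WDW : W *m (Z1^t* *m Z2) = D *m W.
  by rewrite -MQ /W mulmxA -(mulmxA V) -TQM VT mulmxA.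
have Dunit : D \in unitmx by rewrite unitmxE detD unitfE.
have Vfree : row_free V.
  apply/row_freeP; exists (V^t*).
  move/unitarymxP/matrixP: Uu => Uu'; apply/matrixP => i j.
  have := Uu' (widen_ord kn i) (widen_ord kn j); rewrite !mxE.
  have -> : (widen_ord kn i == widen_ord kn j) = (i == j) by rewrite -!val_eqE.
  by move=> <-; apply: eq_bigr => l _; rewrite !mxE.
(* [D] is invertible, so multiplication by [Q] loses no dimension *)
have Wfree : row_free W.
  have rDV : \rank (D *m V) = k.
    by rewrite mxrankMfree // mxrank_unit.
  rewrite -row_leq_rank -[X in (X <= _)%N]rDV -VT TQM mulmxA.
  exact: mxrankM_maxl.
have W0 := gram_det_gt0 Wfree.
have key : p * \det (W *m W^t*) = \det ((Z1 *m W^t*)^t* *m (Z2 *m W^t*)).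
  by rewrite -detD -det_mulmx [D *m _]mulmxA -WDW adjmx_mul trmxCK !mulmxA.
rewrite -(ler_pM2r (exprn_gt0 2 W0)) -exprMn key.
have := gram_det_cauchy_schwarz (Z1 *m W^t*) (Z2 *m W^t*).
rewrite -key ger0_norm; last by rewrite mulr_ge0 // ltW.
move=> /le_trans; apply.
have bound (Z V' : 'M[C]_n) (e : nat -> C) : V' \is unitarymx ->
    Z^t* *m Z = V'^t* *m seqdiag n e *m V' -> (forall i, 0 <= e i) ->
    (forall i j, (i <= j)%N -> e j <= e i) ->
    \det ((Z *m W^t*)^t* *m (Z *m W^t*)) <=
    (\prod_(i < k) e i) * \det (W *m W^t*).
  move=> V'u ZV e0 de; rewrite adjmx_mul trmxCK mulmxA -(mulmxA W).
  exact: gram_det_le_prefix ZV e0 de.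
rewrite expr2 mulrACA; apply: ler_pM; rewrite ?gram_det_ge0 //.
  exact: bound Z1U _ _.
exact: bound Z2U _ _.
Qed.

(** * Singular values *)

(** The sorted sequence is continued by zeros beyond [n], which keeps it
    nonnegative and decreasing on all naturals. *)
Lemma sort_antitone (R : realType) n (x : 'I_n -> R) :
  (forall l, 0 <= x l) ->
  exists (s : 'S_n) (sg : nat -> R),
    [/\ forall i, 0 <= sg i, forall i j, (i <= j)%N -> sg j <= sg i &
        forall l : 'I_n, sg l = x (s l)].
Proof.
move=> x0; pose t := [tuple x l | l < n].
pose r := sort (fun a b => b <= a) t.
have rt : perm_eq r t by rewrite perm_sort.
have [s rE] := tuple_permP rt.
have sr : size r = n by rewrite size_sort size_tuple.
exists s, (nth 0 r); split => [i|i j ij|l].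
- have [ir|ri] := ltnP i (size r); last by rewrite nth_default.
  have : nth 0 r i \in t by rewrite -(perm_mem rt) mem_nth.
  by case/mapP => l _ ->.
- have [jr|rj] := ltnP j (size r); last first.
    rewrite [leLHS]nth_default //.
    have [ir|ri] := ltnP i (size r); last by rewrite nth_default.
    have : nth 0 r i \in t by rewrite -(perm_mem rt) mem_nth.
    by case/mapP => l _ ->.
  have tot : total (fun a b : R => b <= a) by move=> a b; exact: le_total.
  have tra : transitive (fun a b : R => b <= a).
    by move=> a b c ba cb; apply: le_trans ba.
  apply: (sorted_leq_nth tra _ 0 (sort_sorted tot t)) => //.
  by rewrite inE; apply: leq_ltn_trans jr.
- by rewrite rE -tnth_nth !tnth_mktuple.
Qed.

Lemma hermfun_conj_diag (R : realType) n (f : R -> R) (H U : 'M[R[i]]_n)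
    (e : 'rV[R[i]]_n) :
  U \is unitarymx -> H = U^t* *m diag_mx e *m U ->
  hermfun f H =
  U^t* *m diag_mx (map_mx (fun z => (f (complex.Re z))%:C%C) e) *m U.
Proof.
move=> Uu HE.
have Hn : H \is normalmx.
  apply/orthomx_spectral_subproof; exists (U, e) => //=.
  by rewrite (invmx_unitary Uu).
have /orthomx_spectralP := Hn.
have Su := spectral_unitarymx H.
rewrite /hermfun (invmx_unitary Su) => HS.
exact: (spectral_fun_unique _ Su Uu (etrans (esym HS) HE)).
Qed.

Lemma gram_spectral (C : numClosedFieldType) n (T : 'M[C]_n) :
  T^t* *m T = (spectralmx (T^t* *m T))^t* *m diag_mx (spectral_diag (T^t* *m T))
    *m spectralmx (T^t* *m T).
Proof.
have Hn : T^t* *m T \is normalmx.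
  by apply/normalmxP; rewrite adjmx_mul trmxCK.
have /orthomx_spectralP HS := Hn.
by rewrite {1}HS (invmx_unitary (spectral_unitarymx _)).
Qed.

(** The singular values in decreasing order.  The last clause evaluates every
    function of [mxabs T] in this one basis, although the functional calculus of
    [mxabs T] uses a diagonalization chosen independently. *)
Lemma singular_values (R : realType) n (T : 'M[R[i]]_n) :
  exists (U : 'M[R[i]]_n) (sg : nat -> R),
  [/\ U \is unitarymx, forall i, 0 <= sg i,
      forall i j, (i <= j)%N -> sg j <= sg i,
      T^t* *m T = U^t* *m seqdiag n (fun l => (sg l ^+ 2)%:C%C) *m U &
      forall f : R -> R,
        hermfun f (mxabs T) = U^t* *m seqdiag n (fun l => (f (sg l))%:C%C) *m U].
Proof.
have TS := gram_spectral T; have Su := spectral_unitarymx (T^t* *m T).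
move: (spectralmx _) (spectral_diag _) Su TS => S d Su TS.
have d0 := gram_spectral_ge0 Su TS.
have [s [sg [sg0 sgd sgE]]] :=
  sort_antitone (fun l => sqrtr_ge0 (complex.Re (d 0 l))).
pose U := row_perm s S.
have Uu : U \is unitarymx by exact: row_perm_unitary.
have TU : T^t* *m T = U^t* *m seqdiag n (fun l => (sg l ^+ 2)%:C%C) *m U.
  rewrite TS -(conj_row_perm_diag s) /seqdiag.
  suff -> : col_perm s d = \row_l (sg l ^+ 2)%:C%C by exact: erefl.
  apply/rowP => l; rewrite !mxE sgE sqr_sqrtr.
    by rewrite RRe_real // ger0_real.
  by move: (d0 (s l)); rewrite lecE => /andP[].
have absU : mxabs T = U^t* *m seqdiag n (fun l => (sg l)%:C%C) *m U.
  rewrite /mxabs /mxpowR (hermfun_conj_diag _ Uu TU).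
  rewrite /seqdiag; set v := (X in diag_mx X).
  suff -> : v = \row_l (sg l)%:C%C by exact: erefl.
  apply/rowP => l; rewrite !mxE /=.
  by rewrite powR12_sqrt ?sqr_ge0 // sqrtr_sqr ger0_norm.
exists U, sg; split; [exact: Uu|exact: sg0|exact: sgd|exact: TU|move=> f].
rewrite (hermfun_conj_diag _ Uu absU) /seqdiag; set v := (X in diag_mx X).
suff -> : v = \row_l (f (sg l))%:C%C by exact: erefl.
by apply/rowP => l; rewrite !mxE.
Qed.

(** * Symmetric gauge functions and log-majorization *)

(** The properties that the map from diagonals to norms inherits from unitary
    invariance: transpositions and sign changes of the coordinates. *)
Record symmetric_gauge (R : realType) (n : nat) (Phi : 'rV[R]_n -> R) : Prop :=
  SymmetricGauge {
    gauge_ge0 : forall v : 'rV[R]_n, 0 <= Phi v;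
    gaugeZ : forall a (v : 'rV[R]_n), 0 <= a -> Phi (a *: v) = a * Phi v;
    gaugeD : forall u v : 'rV[R]_n, Phi (u + v) <= Phi u + Phi v;
    gauge_xcol : forall i j (v : 'rV[R]_n), Phi (xcol i j v) = Phi v;
    gauge_flip : forall i (v : 'rV[R]_n),
      Phi (\row_l (if l == i then - v 0 l else v 0 l)) = Phi v
  }.

Definition rowf (R : realType) n (b : nat -> R) : 'rV[R]_n := \row_l b l.

Definition upd (R : realType) (b : nat -> R) (i : nat) (x : R) (l : nat) : R :=
  if l == i then x else b l.

Section GaugeMajorization.
Variables (R : realType) (n : nat) (Phi : 'rV[R]_n -> R).
Hypothesis gPhi : symmetric_gauge Phi.
Implicit Types a b : nat -> R.

Lemma gauge_convex_le (u v w : 'rV[R]_n) (t : R) :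
  0 <= t -> t <= 1 -> u = t *: v + (1 - t) *: w -> Phi w = Phi v ->
  Phi u <= Phi v.
Proof.
move=> t0 t1 -> wv; apply: le_trans (gaugeD gPhi _ _) _.
by rewrite !(gaugeZ gPhi) ?subr_ge0 // wv -mulrDl addrC subrK mul1r.
Qed.

(** Shrinking a coordinate is averaging a vector with its image under the
    sign change of that coordinate. *)
Lemma gauge_upd_le b (i : 'I_n) (x : R) :
  0 <= x -> x <= b i -> Phi (rowf n (upd b i x)) <= Phi (rowf n b).
Proof.
move=> x0 xb; have [bi0|bi0] := eqVneq (b i) 0.
  have xE : x = b i by apply/eqP; rewrite eq_le xb bi0 x0.
  suff -> : rowf n (upd b i x) = rowf n b by [].
  apply/rowP => l; rewrite !mxE /upd; case: eqP => // E.
  by rewrite xE E.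
have bp : 0 < b i by rewrite lt_def bi0 (le_trans x0).
pose t := (b i + x) / (2 * b i).
apply: (@gauge_convex_le _ _
    (\row_l (if l == i then - rowf n b 0 l else rowf n b 0 l)) t).
- by rewrite /t divr_ge0 // ?addr_ge0 // ?mulr_ge0 // ltW.
- by rewrite /t ler_pdivrMr ?mulr_gt0 //; lra.
- apply/rowP => l; rewrite !mxE /upd -val_eqE; case: eqP => [E|_].
    by rewrite /t E; field; exact: bi0.
  by ring.
- exact: gauge_flip.
Qed.

(** A Robin Hood transfer between two coordinates averages a vector with its
    image under their transposition. *)
Lemma gauge_transfer_le b (i j : 'I_n) (p : R) :
  i != j -> b j <= p -> p <= b i ->
  Phi (rowf n (upd (upd b i p) j (b i + b j - p))) <= Phi (rowf n b).
Proof.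
move=> ij bp pb.
have [E|bij] := eqVneq (b i) (b j).
  have pE : p = b i by apply/eqP; rewrite eq_le pb E bp.
  suff -> : rowf n (upd (upd b i p) j (b i + b j - p)) = rowf n b by [].
  apply/rowP => l; rewrite !mxE /upd; case: eqP => [->|_]; first by lra.
  by case: eqP => [->|_].
have bd : 0 < b i - b j by rewrite subr_gt0 lt_def bij (le_trans bp).
pose t := (p - b j) / (b i - b j).
apply: (@gauge_convex_le _ _ (xcol i j (rowf n b)) t).
- by rewrite /t divr_ge0 //; lra.
- by rewrite /t ler_pdivrMr //; lra.
- apply/rowP => l; rewrite !mxE /upd.
  have bd0 : b i - b j != 0 by rewrite gt_eqF.
  case: eqP => [/val_inj ->|lj].
    by rewrite tpermR /t; field.
  case: eqP => [/val_inj ->|li].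
    by rewrite tpermL /t; field.
  rewrite tpermD; first by ring.
    by apply/eqP => E; apply: li; rewrite E.
  by apply/eqP => E; apply: lj; rewrite E.
- exact: gauge_xcol.
Qed.

(** A transfer that keeps the product of two coordinates and stops as soon as
    one of them reaches its target. *)
Lemma mul_transfer_exists (ai aj bi bj : R) :
  aj <= ai -> 0 <= bj -> bj < aj -> ai < bi ->
  exists p q, [/\ ai <= p <= bi, bj <= q <= aj, p * q = bi * bj &
    p = ai \/ q = aj].
Proof.
move=> aji bj0 bja aib.
have aj0 : 0 < aj by apply: le_lt_trans bja.
have ai0 : 0 < ai by apply: lt_le_trans aji.
have [h|h] := leP (bi * bj) (ai * aj).
  exists ai, (bi * bj / ai); split.
  - by rewrite lexx ltW.
  - rewrite ler_pdivlMr // ler_pdivrMr // (mulrC aj) h andbT.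
    by rewrite mulrC ler_wpM2r // ltW.
  - by field; rewrite gt_eqF.
  - by left.
exists (bi * bj / aj), aj; split.
- rewrite ler_pdivlMr // ler_pdivrMr // ltW //= ler_wpM2l // ltW //.
  by apply: lt_trans aib.
- by rewrite lexx ltW.
- by field; rewrite gt_eqF.
- by right.
Qed.

Lemma prod_upd2 b (i j k : nat) (p q : R) :
  (i < j)%N -> (j < k)%N -> p * q = b i * b j ->
  \prod_(l < k) upd (upd b i p) j q l = \prod_(l < k) b l.
Proof.
move=> ij jk pq.
have ik : (i < k)%N by apply: ltn_trans jk.
rewrite (bigD1 (Ordinal ik)) //= (bigD1 (Ordinal jk)) /=; last first.
  by rewrite -val_eqE /= gtn_eqF.
rewrite [RHS](bigD1 (Ordinal ik)) //= [X in _ = _ * X](bigD1 (Ordinal jk)) /=; last first.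
  by rewrite -val_eqE /= gtn_eqF.
rewrite !mulrA {1 2}/upd (ltn_eqF ij) eqxx {1}/upd eqxx pq; congr (_ * _).
apply: eq_bigr => l /andP[]; rewrite -!val_eqE /= /upd => li lj.
by rewrite (negbTE li) (negbTE lj).
Qed.

(** Induction on the number of coordinates where [a] and [b] differ.  If
    [a <= b], lower one coordinate of [b] to its target.  Otherwise take the
    first [j] with [b j < a j] and the last [i < j] with [a i < b i], and move
    a factor from [b i] to [b j] until one of the two agrees with [a].  A
    transfer of factors is a transfer of summands followed by a decrease,
    because it keeps the product while bringing the terms closer. *)
Lemma gauge_log_majorization a b :
  (forall i, 0 <= a i) -> (forall i, 0 <= b i) ->
  (forall i j, (i <= j)%N -> a j <= a i) ->
  (forall k, (k <= n)%N -> \prod_(l < k) a l <= \prod_(l < k) b l) ->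
  Phi (rowf n a) <= Phi (rowf n b).
Proof.
move=> a0 + ad.
have [m] := ubnP #|[pred l : 'I_n | a l != b l]|.
elim: m b => // m IH b; rewrite ltnS => cm b0 ab.
have decrease (b' : nat -> R) (i : 'I_n) :
    a i != b i -> a i = b' i -> (forall l : 'I_n, a l = b l -> a l = b' l) ->
    (#|[pred l : 'I_n | a l != b' l]| < m)%N.
  move=> abi ab'i hb; apply: leq_trans cm; apply: proper_card.
  apply/properP; split; last by exists i; rewrite !inE ?abi // ab'i eqxx.
  apply/fintype.subsetP => l; rewrite !inE.
  by apply: contra => /eqP /hb ->.
have [/existsP[j0 j0P]|noj] := boolP [exists j : 'I_n, b j < a j]; last first.
  have leab (l : 'I_n) : a l <= b l.
    by move: noj => /existsPn /(_ l); rewrite -leNgt.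
  have [/existsP[i iP]|noi] := boolP [exists i : 'I_n, a i != b i]; last first.
    suff -> : rowf n a = rowf n b by [].
    apply/rowP => l; rewrite !mxE; apply/eqP.
    by move: noi => /existsPn /(_ l); rewrite negbK.
  apply: le_trans (gauge_upd_le (a0 i) (leab i)).
  apply: IH.
  - apply: (decrease _ i) => //; first by rewrite /upd eqxx.
    by move=> l E; rewrite /upd; case: eqP => // ->.
  - by move=> l; rewrite /upd; case: eqP.
  - move=> k kn; apply: ler_prod => l _; rewrite a0 /= /upd.
    case: eqP => [->//|_]; exact: (leab (widen_ord kn l)).
have exj : exists j, (j < n)%N && (b j < a j) by exists j0; rewrite ltn_ord.
case: (ex_minnP exj) => j /andP[jn bja] jmin {j0 j0P exj}.
have leab l : (l < j)%N -> a l <= b l.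
  move=> lj; rewrite leNgt; apply: contraL lj => h; rewrite -leqNgt.
  have [ln|nl] := ltnP l n; last by apply: leq_trans nl; apply: ltnW.
  by apply: jmin; rewrite ln.
have aj0 : 0 < a j by apply: le_lt_trans bja.
(* otherwise [a] and [b] agree before [j], and the products of the first
   [j + 1] terms contradict the hypothesis *)
have exi : exists i, (i < j)%N && (a i < b i).
  apply: contrapT => noi.
  have eqab l : (l < j)%N -> a l = b l.
    move=> lj; apply/eqP; rewrite eq_le leab //= leNgt; apply/negP => h.
    by apply: noi; exists l; rewrite lj.
  have := ab j.+1 jn; rewrite !big_ord_recr /=.
  rewrite (eq_bigr (fun l : 'I_j => a l)) => [|l _]; last by rewrite eqab.
  under [X in X * b j]eq_bigr do rewrite -eqab //.
  rewrite leNgt ltr_pM2l ?bja // prodr_gt0 // => l _.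
  by apply: lt_le_trans (ad _ _ (ltnW (ltn_ord l))).
have bnd i : (i < j)%N && (a i < b i) -> (i <= j)%N by case/andP=> /ltnW.
case: (ex_maxnP exi bnd) => i /andP[ij aib] imax {exi bnd}.
have in_ : (i < n)%N by apply: ltn_trans jn.
have [p [q [/andP[ap pb] /andP[bq qa] pq pqa]]] :=
  mul_transfer_exists (ad _ _ (ltnW ij)) (b0 j) bja aib.
have ai0 : 0 < a i by apply: lt_le_trans (ad _ _ (ltnW ij)).
have p0 : 0 < p by apply: lt_le_trans ap.
have bjp : b j <= p.
  by rewrite (le_trans (ltW bja)) // (le_trans _ ap) // ad // ltnW.
pose oi := Ordinal in_; pose oj := Ordinal jn.
have oij : oi != oj by rewrite -val_eqE /= ltn_eqF.
have := gauge_transfer_le oij (bjp : b oj <= p) pb.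
apply: le_trans.
(* [b i * b j = p * q] and [b j <= p <= b i] give [(p - b i) * (p - b j) <= 0] *)
have qle : q <= b i + b j - p.
  by rewrite -(ler_pM2l p0) pq; nra.
have := @gauge_upd_le (upd (upd b i p) j (b i + b j - p)) oj q (le_trans (b0 j) bq).
rewrite /= {1}/upd eqxx => /(_ qle); apply: le_trans.
have -> : rowf n (upd (upd (upd b i p) j (b i + b j - p)) j q) =
  rowf n (upd (upd b i p) j q).
  by apply/rowP => l; rewrite !mxE /upd; case: eqP.
apply: IH.
- have hb (l : 'I_n) : a l = b l -> a l = upd (upd b i p) j q l.
    move=> E; rewrite /upd; case: eqP => [lj|_].
      by move: bja; rewrite -lj E ltxx.
    by case: eqP => [li|//]; move: aib; rewrite -li E ltxx.
  case: pqa => [pa|qa'].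
    apply: (decrease _ oi) => //=; first by rewrite lt_eqF.
    by rewrite /upd (ltn_eqF ij) eqxx pa.
  apply: (decrease _ oj) => //=; first by rewrite gt_eqF.
  by rewrite /upd eqxx qa'.
- move=> l; rewrite /upd; case: eqP => _; first by apply: le_trans bq.
  by case: eqP => // _; exact: ltW.
- move=> k kn; have [jk|kj] := ltnP j k; first by rewrite prod_upd2 // ab.
  (* up to [i] nothing changed; from [i] to [j] the new sequence is termwise
     above [a], because [a] and [b] agree strictly between them *)
  have [ki|ik] := leqP k i.
    rewrite (le_trans (ab k kn)) // le_eqVlt; apply/orP; left; apply/eqP.
    apply: eq_bigr => l _; rewrite /upd !ltn_eqF //.
      exact: leq_trans ki.
    exact: leq_trans kj.
  rewrite -!(big_mkord predT) /= !(@big_cat_nat _ _ _ i 0 k) //=; try exact: ltnW.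
  apply: ler_pM; try by apply: prodr_ge0 => l _.
    rewrite !big_mkord (le_trans (ab i (ltnW in_))) // le_eqVlt.
    apply/orP; left; apply/eqP; apply: eq_bigr => l _.
    by rewrite /upd !ltn_eqF // (ltn_trans _ ij).
  rewrite !big_nat; apply: ler_prod => l /andP[il lk]; rewrite a0 /=.
  rewrite /upd ltn_eqF ?(leq_trans lk) //; case: eqP => [->//|/eqP li].
  by rewrite leab // (leq_trans lk).
Qed.

End GaugeMajorization.

(** * A Cauchy-Schwarz inequality for unitarily invariant norms *)

(** The norm as a function of real diagonals, hence of singular values. *)
Definition norm_gauge (R : realType) n (N : 'M[R[i]]_n -> R) (v : 'rV[R]_n) : R :=
  N (diag_mx (\row_l (v 0 l)%:C%C)).

Lemma tperm_mx_unitary (C : numClosedFieldType) n (i j : 'I_n) :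
  (tperm_mx i j : 'M[C]_n) \is unitarymx.
Proof.
apply/unitarymxP; have -> : (tperm_mx i j : 'M[C]_n)^t* = tperm_mx i j.
  by rewrite tr_tperm_mx map_perm_mx.
by rewrite -perm_mxM tperm2 perm_mx1.
Qed.

Definition flip_mx (C : numClosedFieldType) n (i : 'I_n) : 'M[C]_n :=
  diag_mx (\row_l (if l == i then -1 else 1)).

Lemma flip_mx_unitary (C : numClosedFieldType) n (i : 'I_n) :
  flip_mx C i \is unitarymx.
Proof.
apply/unitarymxP; rewrite tr_diag_mx map_diag_mx mulmx_diag -scalemx1.
rewrite scale1r -diag_const_mx; congr diag_mx; apply/rowP => l; rewrite !mxE.
by case: eqP => _; rewrite ?rmorphN1 ?mulrNN ?rmorph1 mulr1.
Qed.

Lemma conj_tperm_diag (C : numClosedFieldType) n (i j : 'I_n) (v : 'rV[C]_n) :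
  tperm_mx i j *m diag_mx v *m tperm_mx i j = diag_mx (xcol i j v).
Proof.
rewrite -xrowE -xcolE; apply/matrixP => a b; rewrite !mxE.
by rewrite (inj_eq perm_inj).
Qed.

Lemma unitary1mx (C : numClosedFieldType) n : (1%:M : 'M[C]_n) \is unitarymx.
Proof. by apply/unitarymxP; rewrite trmx1 map_mx1 mulmx1. Qed.

Lemma flip_mx_diag (C : numClosedFieldType) n (i : 'I_n) (v : 'rV[C]_n) :
  flip_mx C i *m diag_mx v *m 1%:M =
  diag_mx (\row_l (if l == i then - v 0 l else v 0 l)).
Proof.
rewrite mulmx1 mulmx_diag; congr diag_mx; apply/rowP => l; rewrite !mxE.
by case: eqP; rewrite ?mul1r // mulN1r.
Qed.

Lemma norm_gauge_symmetric (R : realType) n (N : 'M[R[i]]_n -> R) :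
  is_mxnorm N -> unitarily_invariant N -> symmetric_gauge (norm_gauge N).
Proof.
move=> hN hU; split.
- by move=> v; exact: mxnorm_ge0 hN _.
- move=> a v a0; rewrite /norm_gauge.
  have -> : \row_l ((a *: v) 0 l)%:C%C = a%:C%C *: \row_l (v 0 l)%:C%C.
    by apply/rowP => l; rewrite !mxE rmorphM.
  by rewrite linearZ (mxnormZ hN) ger0_norm // ler0c.
- move=> u v; rewrite /norm_gauge.
  have -> : \row_l ((u + v) 0 l)%:C%C =
      \row_l (u 0 l)%:C%C + \row_l (v 0 l)%:C%C.
    by apply/rowP => l; rewrite !mxE rmorphD.
  rewrite linearD; exact: mxnormD hN _ _.
- move=> i j v; rewrite /norm_gauge.
  have -> : \row_l (xcol i j v 0 l)%:C%C = xcol i j (\row_l (v 0 l)%:C%C).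
    by apply/rowP => l; rewrite !mxE.
  by rewrite -conj_tperm_diag; apply: hU; exact: tperm_mx_unitary.
- move=> i v; rewrite /norm_gauge.
  set w := (X in diag_mx X).
  have -> : w = \row_l (if l == i then - (\row_l (v 0 l)%:C%C : 'rV[R[i]]_n) 0 l
      else (\row_l (v 0 l)%:C%C : 'rV[R[i]]_n) 0 l).
    by apply/rowP => l; rewrite !mxE; case: eqP => // _; rewrite rmorphN.
  rewrite -flip_mx_diag; apply: hU; [exact: flip_mx_unitary|exact: unitary1mx].
Qed.

Lemma norm_conj_seqdiag (R : realType) n (N : 'M[R[i]]_n -> R) (U : 'M[R[i]]_n)
    (x : nat -> R) :
  unitarily_invariant N -> U \is unitarymx ->
  N (U^t* *m seqdiag n (fun l => (x l)%:C%C) *m U) = norm_gauge N (rowf n x).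
Proof.
move=> hU Uu; have Utu : U^t* \is unitarymx by rewrite trmxC_unitary.
rewrite (hU _ _ _ Utu Uu) /norm_gauge /seqdiag.
suff -> : \row_l (x l)%:C%C = \row_l (rowf n x 0 l)%:C%C :> 'rV_n.
  exact: erefl.
by apply/rowP => l; rewrite !mxE.
Qed.

Lemma prod_powR (R : realType) (s : nat -> R) (r : R) k :
  (forall i, 0 <= s i) ->
  \prod_(l < k) (s l `^ r) = (\prod_(l < k) s l) `^ r.
Proof.
move=> s0; elim: k => [|k IH]; first by rewrite !big_ord0 powR1.
by rewrite !big_ord_recr /= IH powRM ?prodr_ge0.
Qed.

(** The bound at [c = p / q] is the claim; when [q = 0], letting [c] be large
    forces [p = 0]. *)
Lemma sqr_le_of_amgm (R : realFieldType) (p q w : R) :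
  0 <= p -> 0 <= q -> 0 <= w ->
  (forall c, 0 < c -> 2 * p <= c * q + c^-1 * w) -> p ^+ 2 <= q * w.
Proof.
move=> p0 q0 w0 h; rewrite leNgt; apply/negP => pqw.
have pp : 0 < p.
  rewrite lt_def p0 andbT; apply: contraL pqw => /eqP ->.
  by rewrite -leNgt expr0n mulr_ge0.
have [qz|qp] := eqVneq q 0.
  (* any [c] larger than [w / (2 * p)] gives a contradiction *)
  have /h : 0 < (w + 1) / p by rewrite divr_gt0 // ltr_wpDl.
  rewrite qz mulr0 add0r invf_div mulrAC ler_pdivlMr ?ltr_wpDl //.
  by nra.
have qpos : 0 < q by rewrite lt_def qp.
have := h (p / q) (divr_gt0 pp qpos).
rewrite divfK // invf_div => hh.
have : p <= q / p * w by lra.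
rewrite mulrAC ler_pdivlMr // -expr2 leNgt.
by rewrite pqw.
Qed.

(** Cauchy-Schwarz for the norm of [|T|^r].  Instead of a Cauchy-Schwarz
    inequality for gauges, the singular values of [T] are compared with
    weighted arithmetic means [b], which dominate the geometric means of those of
    [Z1] and [Z2]; this needs only subadditivity, and the weight [c] is optimized
    at the end. *)
Lemma spectral_norm_sq_le (R : realType) n (N : 'M[R[i]]_n -> R) (r : R)
    (T Q M Z1 Z2 : 'M[R[i]]_n) :
  is_mxnorm N -> unitarily_invariant N -> 0 <= r ->
  T^t* *m T = Q *m M -> M *m Q = Z1^t* *m Z2 ->
  N (mxpowR (mxabs T) r) ^+ 2 <=
  N (mxpowR (mxabs Z1) r) * N (mxpowR (mxabs Z2) r).
Proof.
move=> hN hU r0 TQ MQ.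
have [U [s [Uu s0 sd sT sf]]] := singular_values T.
have [U1 [s1 [U1u s10 s1d s1T s1f]]] := singular_values Z1.
have [U2 [s2 [U2u s20 s2d s2T s2f]]] := singular_values Z2.
have gN := norm_gauge_symmetric hN hU.
rewrite /mxpowR sf s1f s2f !(norm_conj_seqdiag _ hU) //.
have prefix k : (k <= n)%N ->
    (\prod_(l < k) s l) ^+ 2 <= (\prod_(l < k) s1 l) * (\prod_(l < k) s2 l).
  move=> kn.
  have sqC (t : nat -> R) :
      (\prod_(l < k) (t l ^+ 2)%:C)%C = ((\prod_(l < k) t l) ^+ 2)%:C%C.
    by rewrite -rmorph_prod prodrXl.
  have ge0C (t : nat -> R) i : 0 <= (t i ^+ 2)%:C%C by rewrite ler0c sqr_ge0.
  have antiC (t : nat -> R) : (forall i, 0 <= t i) ->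
      (forall i j, (i <= j)%N -> t j <= t i) ->
      forall i j, (i <= j)%N -> (t j ^+ 2)%:C%C <= (t i ^+ 2)%:C%C.
    by move=> t0 td i j ij; rewrite lecR lerXn2r ?nnegrE ?td.
  have := spectral_prefix_le TQ MQ Uu U1u U2u sT s1T s2T (ge0C s) (ge0C s1)
    (ge0C s2) (antiC _ s10 s1d) (antiC _ s20 s2d) kn.
  rewrite !sqC -rmorphXn -rmorphM lecR -exprMn => h.
  by rewrite -(@ler_pXn2r _ 2) // nnegrE ?exprn_ge0 ?mulr_ge0 ?prodr_ge0.
apply: sqr_le_of_amgm; try exact: (gauge_ge0 gN).
move=> c c0; have ci0 : 0 < c^-1 by rewrite invr_gt0.
pose b l := (c * (s1 l `^ r) + c^-1 * (s2 l `^ r)) / 2.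
have b0 l : 0 <= b l.
  by rewrite /b divr_ge0 // addr_ge0 // mulr_ge0 ?powR_ge0 // ltW.
have maj : norm_gauge N (rowf n (fun l => s l `^ r)) <= norm_gauge N (rowf n b).
  apply: gauge_log_majorization => //.
  - by move=> l; exact: powR_ge0.
  - by move=> i j ij; apply: ge0_ler_powR; rewrite ?nnegrE ?sd.
  - move=> k kn; rewrite -(@ler_pXn2r _ 2) ?nnegrE //; try exact: prodr_ge0.
      rewrite prod_powR // -powR_mulrn ?powR_ge0 // powRAC powR_mulrn ?prodr_ge0 //.
      have := ge0_ler_powR r0 _ _ (prefix k kn).
      rewrite !nnegrE exprn_ge0 ?mulr_ge0 ?prodr_ge0 // => /(_ isT isT) /le_trans.
      apply; rewrite powRM ?prodr_ge0 // -!prod_powR // -big_split /= -prodrXl.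
      apply: ler_prod => l _; rewrite mulr_ge0 ?powR_ge0 //= /b.
      move: (s1 l `^ r) (s2 l `^ r) => x y.
      have -> : x * y = (c * x) * (c^-1 * y) by field; rewrite gt_eqF.
      move: (c * x) (c^-1 * y) => {}x {}y.
      by have := sqr_ge0 (x - y); nra.
    by apply: prodr_ge0 => l _; exact: powR_ge0.
have split : rowf n b = 2^-1 *: (c *: rowf n (fun l => s1 l `^ r) +
    c^-1 *: rowf n (fun l => s2 l `^ r)).
  by apply/rowP => l; rewrite !mxE /b mulrC.
have := maj; rewrite split (gaugeZ gN) ?invr_ge0 //.
have := gaugeD gN (c *: rowf n (fun l => s1 l `^ r))
   (c^-1 *: rowf n (fun l => s2 l `^ r)).
rewrite !(gaugeZ gN) ?(ltW c0) ?(ltW ci0) //.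
by lra.
Qed.

(** * Log-convexity in the exponents *)

(** For nonnegative exponents the law holds at [x = 0] too, thanks to
    [0 `^ 0 = 1]. *)
Lemma powRD_ge0 (R : realType) (x a b : R) : 0 <= a -> 0 <= b ->
  x `^ a * x `^ b = x `^ (a + b).
Proof.
move=> a0 b0; have [->|x0] := eqVneq x 0; last first.
  by rewrite -powRD // x0 implybT.
have [->|a1] := eqVneq a 0; first by rewrite powRr0 mul1r add0r.
rewrite powR0 // mul0r powR0 // gt_eqF // ltr_wpDr //.
by rewrite lt_def a1.
Qed.

Lemma conj_diag_mul (C : numClosedFieldType) n (S : 'M[C]_n) (d e : 'rV[C]_n) :
  S \is unitarymx ->
  (S^t* *m diag_mx d *m S) *m (S^t* *m diag_mx e *m S) =
  S^t* *m diag_mx (\row_l (d 0 l * e 0 l)) *m S.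
Proof.
move=> Su; rewrite !mulmxA mulmxtVK // -(mulmxA (S^t*)).
by rewrite mulmx_diag.
Qed.

Lemma conj_diag_adj (C : numClosedFieldType) n (S : 'M[C]_n) (d : 'rV[C]_n) :
  (forall l, (d 0 l)^*%R = d 0 l) ->
  (S^t* *m diag_mx d *m S)^t* = S^t* *m diag_mx d *m S.
Proof.
move=> dr; rewrite !adjmx_mul trmxCK tr_diag_mx map_diag_mx mulmxA.
suff -> : map_mx Num.conj d = d by [].
by apply/rowP => l; rewrite mxE dr.
Qed.

Lemma mxpowRE (R : realType) n (A : 'M[R[i]]_n) (a : R) :
  mxpowR A a = (spectralmx A)^t* *m
    diag_mx (\row_l (complex.Re (spectral_diag A 0 l) `^ a)%:C%C) *m spectralmx A.
Proof.
rewrite /mxpowR /hermfun (invmx_unitary (spectral_unitarymx A)).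
set v := (X in diag_mx X).
suff -> : v = \row_l (complex.Re (spectral_diag A 0 l) `^ a)%:C%C.
  by exact: erefl.
by apply/rowP => l; rewrite !mxE.
Qed.

Lemma mxpowRD (R : realType) n (A : 'M[R[i]]_n) (a b : R) :
  0 <= a -> 0 <= b -> mxpowR A a *m mxpowR A b = mxpowR A (a + b).
Proof.
move=> a0 b0; rewrite !mxpowRE (conj_diag_mul _ _ (spectral_unitarymx A)).
set v := (X in diag_mx X).
suff -> : v = \row_l (complex.Re (spectral_diag A 0 l) `^ (a + b))%:C%C.
  by exact: erefl.
by apply/rowP => l; rewrite !mxE -rmorphM powRD_ge0.
Qed.

Lemma mxpowR_adj (R : realType) n (A : 'M[R[i]]_n) (a : R) :
  (mxpowR A a)^t* = mxpowR A a.
Proof.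
rewrite mxpowRE conj_diag_adj //= => l; rewrite !mxE.
by apply/CrealP; apply/complex_realP; eexists.
Qed.

(** Two families of self-adjoint matrices with the semigroup law, and a functional
    satisfying the Cauchy-Schwarz inequality above, abstracted from the powers
    of [A] and [B] and the norm of [|T|^r]. *)
Section PowerFamilies.
Variables (R : realFieldType) (C : numClosedFieldType) (n : nat).
Variables (PA PB : R -> 'M[C]_n) (X : 'M[C]_n) (G : 'M[C]_n -> R).
Hypothesis PA_adj : forall a, (PA a)^t* = PA a.
Hypothesis PB_adj : forall b, (PB b)^t* = PB b.
Hypothesis PAD : forall a b, 0 <= a -> 0 <= b -> PA a *m PA b = PA (a + b).
Hypothesis PBD : forall a b, 0 <= a -> 0 <= b -> PB a *m PB b = PB (a + b).
Hypothesis G_sq_le : forall T Q M Z1 Z2 : 'M[C]_n,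
  T^t* *m T = Q *m M -> M *m Q = Z1^t* *m Z2 -> G T ^+ 2 <= G Z1 * G Z2.

Let PXP a b := PA a *m X *m PB b.

Lemma sandwichE a b u v : 0 <= a -> 0 <= b -> 0 <= u -> 0 <= v ->
  PXP (v + a) (b + u) = PA v *m PXP a b *m PB u.
Proof. by move=> *; rewrite /PXP -PAD // -PBD // !mulmxA. Qed.

(** Here [M *m Q] is [Y^t*] times [P *m P *m Y *m Q *m Q], with [Y] the product
    at (a, b), [P] and [Q] the steps by [v] and [u]. *)
Lemma sandwich_sq_le_parallel a b u v : 0 <= a -> 0 <= b -> 0 <= u -> 0 <= v ->
  G (PXP (v + a) (b + u)) ^+ 2 <=
  G (PXP a b) * G (PXP (v + v + a) (b + (u + u))).
Proof.
move=> a0 b0 u0 v0.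
rewrite (@sandwichE a b (u + u)) ?addr_ge0 // sandwichE // -PAD // -PBD //.
move: (PXP a b) => Y.
apply: (@G_sq_le _ (PB u) (Y^t* *m PA v *m PA v *m Y *m PB u)).
  by rewrite !adjmx_mul PA_adj PB_adj !mulmxA.
by rewrite !mulmxA.
Qed.

(** The same matrix [M *m Q] as for parallel steps, now bracketed as the
    adjoint of [P *m P *m Y] times [Y *m Q *m Q]. *)
Lemma sandwich_sq_le_opposite a b u v : 0 <= a -> 0 <= b -> 0 <= u -> 0 <= v ->
  G (PXP (v + a) (b + u)) ^+ 2 <=
  G (PXP (v + v + a) b) * G (PXP a (b + (u + u))).
Proof.
move=> a0 b0 u0 v0.
have -> : PXP (v + v + a) b = PA v *m PA v *m PXP a b.
  by rewrite /PXP -PAD ?addr_ge0 // -(PAD v0 v0) !mulmxA.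
have -> : PXP a (b + (u + u)) = PXP a b *m (PB u *m PB u).
  by rewrite /PXP -PBD ?addr_ge0 // -(PBD u0 u0) !mulmxA.
rewrite sandwichE //; move: (PXP a b) => Y.
apply: (@G_sq_le _ (PB u) (Y^t* *m PA v *m PA v *m Y *m PB u)).
  by rewrite !adjmx_mul PA_adj PB_adj !mulmxA.
by rewrite !adjmx_mul !PA_adj !mulmxA.
Qed.

Lemma midpoint_sq_le a a' b b' :
  0 <= a -> 0 <= a' -> 0 <= b -> 0 <= b' ->
  G (PA ((a + a') / 2) *m X *m PB ((b + b') / 2)) ^+ 2 <=
  G (PA a *m X *m PB b) * G (PA a' *m X *m PB b').
Proof.
rewrite -!/(PXP _ _).
wlog aa' : a a' b b' / a <= a'.
  move=> H a0 a'0 b0 b'0; have [|/ltW] := leP a a'; first by move=> *; exact: H.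
  by move=> a'a; rewrite (addrC a) (addrC b) [leRHS]mulrC; exact: H.
move=> a0 a'0 b0 b'0; pose v := (a' - a) / 2.
have v0 : 0 <= v by rewrite /v; lra.
have mE : (a + a') / 2 = v + a by rewrite /v; field.
have eE : a' = v + v + a by rewrite /v; field.
have [bb'|/ltW bb'] := leP b b'.
  have := @sandwich_sq_le_parallel a b ((b' - b) / 2) v a0 b0 _ v0.
  have -> : b + ((b' - b) / 2 + (b' - b) / 2) = b' by field.
  have -> : b + (b' - b) / 2 = (b + b') / 2 by field.
  by rewrite mE -eE; apply; lra.
have := @sandwich_sq_le_opposite a b' ((b - b') / 2) v a0 b'0 _ v0.
have -> : b' + ((b - b') / 2 + (b - b') / 2) = b by field.
have -> : b' + (b - b') / 2 = (b + b') / 2 by field.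
by rewrite mE -eE => h; rewrite [leRHS]mulrC; apply: h; lra.
Qed.

End PowerFamilies.

Definition power_norm (R : realType) n (A B X : 'M[R[i]]_n) (r : R)
    (N : 'M[R[i]]_n -> R) (a b : R) : R :=
  N (mxpowR (mxabs (mxpowR A a *m X *m mxpowR B b)) r).

Lemma power_norm_midpoint (R : realType) n (A B X : 'M[R[i]]_n) (r : R)
    (N : 'M[R[i]]_n -> R) (a a' b b' : R) :
  0 <= r -> is_mxnorm N -> unitarily_invariant N ->
  0 <= a -> 0 <= a' -> 0 <= b -> 0 <= b' ->
  power_norm A B X r N ((a + a') / 2) ((b + b') / 2) ^+ 2 <=
  power_norm A B X r N a b * power_norm A B X r N a' b'.
Proof.
move=> r0 hN hU a0 a'0 b0 b'0.
have key := fun T Q M Z1 Z2 =>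
  @spectral_norm_sq_le R n N r T Q M Z1 Z2 hN hU r0.
exact: (midpoint_sq_le X (mxpowR_adj A) (mxpowR_adj B) (@mxpowRD R n A)
  (@mxpowRD R n B) key a0 a'0 b0 b'0).
Qed.

(** * Boundedness in the exponents *)

(** Uniform boundedness of a family of matrices in the entrywise norm. *)
Definition entry_bounded (C : numDomainType) (I : Type) m n
    (F : I -> 'M[C]_(m, n)) : Prop :=
  exists2 c : C, 0 <= c & forall a i j, `|F a i j| <= c.

Lemma entry_bounded_cst (C : numDomainType) (I : Type) m n (M : 'M[C]_(m, n)) :
  entry_bounded (fun _ : I => M).
Proof.
exists (\sum_i \sum_j `|M i j|).
  by apply: sumr_ge0 => i _; apply: sumr_ge0.
move=> _ i j; rewrite (bigD1 i) //= (bigD1 j) //= -addrA lerDl addr_ge0 //.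
  by apply: sumr_ge0.
by apply: sumr_ge0 => k _; apply: sumr_ge0.
Qed.

Lemma entry_bounded_mul (C : numDomainType) (I : Type) m n p
    (F : I -> 'M[C]_(m, n)) (G : I -> 'M[C]_(n, p)) :
  entry_bounded F -> entry_bounded G -> entry_bounded (fun a => F a *m G a).
Proof.
move=> [c c0 Fc] [d d0 Gd]; exists (c * d *+ n).
  by rewrite mulrn_wge0 ?mulr_ge0.
move=> a i j; rewrite mxE (le_trans (ler_norm_sum _ _ _)) //.
rewrite -[in leRHS](card_ord n) -sumr_const; apply: ler_sum => k _.
by rewrite normrM ler_pM.
Qed.

Lemma entry_bounded_diag (C : numDomainType) (I : Type) n
    (F : I -> 'rV[C]_n) :
  entry_bounded F -> entry_bounded (fun a => diag_mx (F a)).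
Proof.
move=> [c c0 Fc]; exists c => // a i j; rewrite mxE.
by case: eqP => _; rewrite ?mulr1n // mulr0n normr0.
Qed.

(** A nonzero base gives [expR (a * ln x)] with [a * ln x <= 2 * `|ln x|], and
    a zero base gives 0 or 1. *)
Lemma powR_bounded (R : realType) n (x : 'I_n -> R) :
  exists2 c : R, 0 <= c & forall a l, 0 <= a <= 2 -> x l `^ a <= c.
Proof.
exists (\sum_l expR (2 * `|ln (x l)|)).
  by apply: sumr_ge0 => l _; exact: expR_ge0.
move=> a l /andP[a0 a2]; rewrite (bigD1 l) //=.
apply: (@le_trans _ _ (expR (2 * `|ln (x l)|))); last first.
  by rewrite lerDl sumr_ge0 // => k _; exact: expR_ge0.
have e1 : 1 <= expR (2 * `|ln (x l)|) by rewrite -expR0 ler_expR mulr_ge0.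
rewrite /powR; case: eqP => _.
  by case: eqP => _ /=; rewrite ?expR_ge0.
rewrite ler_expR (le_trans (ler_norm _)) // normrM (ger0_norm a0).
by rewrite ler_wpM2r.
Qed.

Lemma mxpowR_entry_bounded (R : realType) n (A : 'M[R[i]]_n) :
  entry_bounded (fun a : {a : R | 0 <= a <= 2} => mxpowR A (sval a)).
Proof.
have [c c0 hc] := powR_bounded (fun l => complex.Re (spectral_diag A 0 l)).
pose I := {a : R | 0 <= a <= 2}.
pose D (a : I) : 'rV[R[i]]_n :=
  \row_l (complex.Re (spectral_diag A 0 l) `^ (sval a))%:C%C.
have bD : entry_bounded D.
  exists c%:C%C; first by rewrite ler0c.
  move=> [a a02] i j; rewrite mxE ger0_norm ?ler0c ?powR_ge0 //.
  by rewrite lecR hc.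
have := entry_bounded_mul (entry_bounded_mul
  (entry_bounded_cst I ((spectralmx A)^t*)) (entry_bounded_diag bD))
  (entry_bounded_cst I (spectralmx A)).
move=> [e e0 he]; exists e; first exact: e0.
by move=> a i j; rewrite mxpowRE; exact: he.
Qed.

(** The right side is the trace of the Gram matrix, the sum of all [d i] with
    [i < n]. *)
Lemma spectral_le_sum_entries (C : numClosedFieldType) n (T U : 'M[C]_n)
    (d : nat -> C) (l : 'I_n) :
  U \is unitarymx -> T^t* *m T = U^t* *m seqdiag n d *m U ->
  (forall i, 0 <= d i) -> d l <= \sum_i \sum_j `|T j i| ^+ 2.
Proof.
move=> Uu TU d0.
have <- : \tr (T^t* *m T) = \sum_i \sum_j `|T j i| ^+ 2.
  apply: eq_bigr => i _; rewrite mxE; apply: eq_bigr => j _.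
  by rewrite !mxE mulrC normCK.
rewrite TU mxtrace_mulC mulmxA (unitarymxP Uu) mul1mx mxtrace_diag.
rewrite (bigD1 l) //= mxE lerDl; apply: sumr_ge0 => k _.
by rewrite mxE.
Qed.

Lemma spectral_norm_bounded (R : realType) (I : Type) n
    (N : 'M[R[i]]_n -> R) (r : R) (F : I -> 'M[R[i]]_n) :
  is_mxnorm N -> unitarily_invariant N -> 0 <= r -> entry_bounded F ->
  exists K, forall a, N (mxpowR (mxabs (F a)) r) <= K.
Proof.
move=> hN hU r0 [c c0 Fc].
pose cR := complex.Re c.
have cE : c = cR%:C%C by rewrite /cR RRe_real // ger0_real.
pose b : R := Num.sqrt (cR ^+ 2 *+ n *+ n).
exists (norm_gauge N (rowf n (fun=> b `^ r))) => a.
have [U [sg [Uu s0 sd sT sf]]] := singular_values (F a).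
have sb (l : 'I_n) : sg l <= b.
  rewrite -(@ler_pXn2r _ 2) ?nnegrE ?sqrtr_ge0 //.
  rewrite sqr_sqrtr ?mulrn_wge0 ?sqr_ge0 //.
  have := spectral_le_sum_entries l Uu sT (fun i => _).
  rewrite -lecR => /(_ _)/le_trans -> //.
    by move=> i; rewrite ler0c sqr_ge0.
  rewrite !rmorphMn rmorphXn /= -cE.
  rewrite -[in leRHS](card_ord n) -!sumr_const.
  apply: ler_sum => i _; apply: ler_sum => j _.
  by rewrite lerXn2r ?nnegrE.
rewrite {1}/mxpowR sf (norm_conj_seqdiag _ hU Uu).
apply: (gauge_log_majorization (norm_gauge_symmetric hN hU)).
- by move=> l; exact: powR_ge0.
- by move=> l; exact: powR_ge0.
- by move=> i j ij; apply: ge0_ler_powR; rewrite ?nnegrE ?sd.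
- move=> k kn; apply: ler_prod => l _; rewrite powR_ge0 /=.
  by apply: ge0_ler_powR; rewrite ?nnegrE ?sqrtr_ge0 //; exact: (sb (widen_ord kn l)).
Qed.

Lemma power_norm_bounded (R : realType) n (A B X : 'M[R[i]]_n) (r : R)
    (N : 'M[R[i]]_n -> R) :
  0 <= r -> is_mxnorm N -> unitarily_invariant N ->
  exists K, forall a b, 0 <= a <= 2 -> 0 <= b <= 2 ->
    power_norm A B X r N a b <= K.
Proof.
move=> r0 hN hU.
pose I := ({a : R | 0 <= a <= 2} * {a : R | 0 <= a <= 2})%type.
have [cA cA0 hA] := mxpowR_entry_bounded A.
have [cB cB0 hB] := mxpowR_entry_bounded B.
have bA : entry_bounded (fun p : I => mxpowR A (sval p.1)).
  by exists cA => // p i j; exact: hA.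
have bB : entry_bounded (fun p : I => mxpowR B (sval p.2)).
  by exists cB => // p i j; exact: hB.
have [K hK] := spectral_norm_bounded hN hU r0
  (entry_bounded_mul (entry_bounded_mul bA (entry_bounded_cst I X)) bB).
exists K => a b ha hb.
exact: (hK (exist _ a ha, exist _ b hb)).
Qed.

(** * Convexity from midpoint convexity *)

(** The excess [g] over the chord is midpoint convex and vanishes at both
    ends.  Every point is the midpoint of an end and another point, so any upper
    bound of [g] may be halved, and [g <= 0]. *)
Lemma midpoint_convex_bounded (R : realType) (phi : R -> R) (K : R) :
  (forall x y, 0 <= x <= 1 -> 0 <= y <= 1 ->
    phi ((x + y) / 2) <= (phi x + phi y) / 2) ->
  (forall x, 0 <= x <= 1 -> phi x <= K) ->
  forall t, 0 <= t <= 1 -> phi t <= t * phi 1 + (1 - t) * phi 0.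
Proof.
move=> mid bnd t t01; rewrite -subr_le0.
pose g x := phi x - (x * phi 1 + (1 - x) * phi 0).
rewrite -/(g t).
pose S := `|K| + `|phi 0| + `|phi 1|.
have S0 : 0 <= S by rewrite !addr_ge0.
have gS x : 0 <= x <= 1 -> g x <= S.
  move=> /andP[x0 x1]; have xK := bnd x; rewrite x0 x1 in xK.
  have := xK isT; have := ler_norm K.
  have h0 : - ((1 - x) * phi 0) <= `|phi 0|.
    rewrite -mulrN (le_trans (ler_norm _)) // normrM normrN.
    by rewrite ler_piMl // ger0_norm ?subr_ge0 // gerBl.
  have h1 : - (x * phi 1) <= `|phi 1|.
    rewrite -mulrN (le_trans (ler_norm _)) // normrM normrN.
    by rewrite ler_piMl // ger0_norm.
  by rewrite /g /S => *; lra.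
have gm m x : 0 <= x <= 1 -> g x <= S / 2 ^+ m.
  elim: m x => [|m IH] x x01; first by rewrite expr0 divr1 gS.
  have half (y z : R) : 0 <= y <= 1 -> 0 <= z <= 1 -> x = (y + z) / 2 ->
      g x <= (g y + g z) / 2.
    by move=> y01 z01 ->; have := mid y z y01 z01; rewrite /g; lra.
  have g0 : g 0 = 0 by rewrite /g; ring.
  have g1 : g 1 = 0 by rewrite /g; ring.
  have -> : S / 2 ^+ m.+1 = (S / 2 ^+ m) / 2.
    by rewrite exprS; field; rewrite expf_neq0.
  have [x2|x2] := leP x 2^-1.
    have y01 : 0 <= 2 * x <= 1 by lra.
    have z01 : 0 <= (0 : R) <= 1 by rewrite lexx ler01.
    have xE : x = (0 + 2 * x) / 2 by lra.
    have := half _ _ z01 y01 xE.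
    by have := IH _ y01; rewrite g0; lra.
  have y01 : 0 <= 2 * x - 1 <= 1 by lra.
  have z01 : 0 <= (1 : R) <= 1 by rewrite lexx ler01.
  have xE : x = (1 + (2 * x - 1)) / 2 by lra.
  have := half _ _ z01 y01 xE.
  by have := IH _ y01; rewrite g1; lra.
rewrite leNgt; apply/negP => gt0.
have := upper_nthrootP (leqnn (Num.bound (S / g t))).
set m := Num.bound _ => h.
have := gm m t t01; rewrite leNgt => /negP; apply.
by rewrite ltr_pdivrMr ?exprn_gt0 // mulrC -ltr_pdivrMr.
Qed.

(** Multiply the two hypotheses and apply the arithmetic-geometric mean
    inequality to [g1 * g2] and [h1 * h2]. *)
Lemma prod_midpoint_le (R : realFieldType) (x y g1 g2 h1 h2 : R) :
  0 <= x -> 0 <= y -> 0 <= g1 -> 0 <= g2 -> 0 <= h1 -> 0 <= h2 ->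
  x ^+ 2 <= g1 * h1 -> y ^+ 2 <= g2 * h2 ->
  x * y <= (g1 * g2 + h1 * h2) / 2.
Proof.
move=> x0 y0 g10 g20 h10 h20 hx hy.
rewrite -(@ler_pXn2r _ 2) ?nnegrE ?mulr_ge0 ?addr_ge0 ?mulr_ge0 ?invr_ge0 //.
rewrite exprMn; apply: le_trans (ler_pM (sqr_ge0 _) (sqr_ge0 _) hx hy) _.
rewrite mulrACA; move: (g1 * g2) (h1 * h2) => u v.
by have := sqr_ge0 (u - v); nra.
Qed.

Local Open Scope complex_scope.

Theorem theorem2p3 (R : realType) (n : nat) (A B X : 'M[R[i]]_n) (r : R)
    (N : 'M[R[i]]_n -> R)
    (hA : psdmx A) (hB : psdmx B) (hr : 0 <= r)
    (hN : is_mxnorm N) (hU : unitarily_invariant N) :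
  let F (s t : R) : R :=
    N (mxpowR (mxabs (mxpowR A (1 - t) *m X *m mxpowR B (1 + s))) r)
    * N (mxpowR (mxabs (mxpowR A (1 + t) *m X *m mxpowR B (1 - s))) r) in
  @convex_function R (R^o * R^o)%type (`[-1, 1] `*` `[-1, 1])
    (fun p => F p.1 p.2)
  /\ (forall s t : R, s \in `[-1, 1] -> t \in `[-1, 1] -> F 0 0 <= F s t).
Proof.
move=> F.
pose G a b := power_norm A B X r N a b.
have FE s t : F s t = G (1 - t) (1 + s) * G (1 + t) (1 - s) by exact: erefl.
have G0 a b : 0 <= G a b by exact: (mxnorm_ge0 hN).
have Gmid a a' b b' : 0 <= a -> 0 <= a' -> 0 <= b -> 0 <= b' ->
    G ((a + a') / 2) ((b + b') / 2) ^+ 2 <= G a b * G a' b'.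
  by move=> *; exact: power_norm_midpoint.
have [K hK] := power_norm_bounded A B X hr hN hU.
have {hK}GK a b : 0 <= a <= 2 -> 0 <= b <= 2 -> G a b <= K by exact: hK.
clearbody G F.
have Fmid s t s' t' : -1 <= s <= 1 -> -1 <= t <= 1 -> -1 <= s' <= 1 ->
    -1 <= t' <= 1 -> F ((s + s') / 2) ((t + t') / 2) <= (F s t + F s' t') / 2.
  move=> hs ht hs' ht'; rewrite !FE.
  have -> : 1 - (t + t') / 2 = ((1 - t) + (1 - t')) / 2 by field.
  have -> : 1 + (t + t') / 2 = ((1 + t) + (1 + t')) / 2 by field.
  have -> : 1 - (s + s') / 2 = ((1 - s) + (1 - s')) / 2 by field.
  have -> : 1 + (s + s') / 2 = ((1 + s) + (1 + s')) / 2 by field.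
  by apply: prod_midpoint_le => //; apply: Gmid; lra.
have FK s t : -1 <= s <= 1 -> -1 <= t <= 1 -> F s t <= K * K.
  by move=> hs ht; rewrite FE ler_pM // GK //; lra.
split.
  move=> l [x1 x2] [y1 y2]; rewrite !inE /=.
  have itvP (z : R^o) : z \in `[-1, 1] -> -1 <= (z : R) <= 1.
    by move=> hz; have : (z : R) \in `[-1, 1] := hz; rewrite in_itv.
  move=> [/itvP hx1 /itvP hx2] [/itvP hy1 /itvP hy2].
  pose phi (m : R) := F (m * x1 + (1 - m) * y1) (m * x2 + (1 - m) * y2).
  have inI (m x y : R) : 0 <= m <= 1 -> -1 <= x <= 1 -> -1 <= y <= 1 ->
    -1 <= m * x + (1 - m) * y <= 1 by move=> *; nra.
  have phi_mid m m' : 0 <= m <= 1 -> 0 <= m' <= 1 ->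
      phi ((m + m') / 2) <= (phi m + phi m') / 2.
    move=> hm hm'; rewrite /phi.
    have E (x y : R) : (m + m') / 2 * x + (1 - (m + m') / 2) * y =
      ((m * x + (1 - m) * y) + (m' * x + (1 - m') * y)) / 2 by field.
    by rewrite !E; apply: Fmid; apply: inI.
  have phi_K m : 0 <= m <= 1 -> phi m <= K * K.
    by move=> hm; apply: FK; apply: inI.
  have l01 : 0 <= (l%:num : R) <= 1 by rewrite ge0 le1.
  have := midpoint_convex_bounded phi_mid phi_K l01.
  by rewrite /phi !mul1r !mul0r !subrr !subr0 !mul0r !mul1r !addr0 !add0r.
move=> s t; rewrite !in_itv /= => hs ht.
have := Fmid s t (- s) (- t) hs ht.
rewrite !subrr !mul0r => /(_ _ _)/le_trans; apply; try by lra.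
by rewrite [F (- s) _]FE !opprK [X in _ + X]mulrC -FE; lra.
Qed.
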